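(* (1) There exists a non-adaptive fully tolerant tester for $k$-monotonicity of functions $f\colon[n]^d\to\{0,1\}$ which, for any $0\leq\varepsilon_1<\varepsilon_2\leq 1$, has query complexity $q(n,d,\varepsilon_1,\varepsilon_2,k)=\tilde{O}\!\left(\frac{1}{(\varepsilon_2-\varepsilon_1)^2}\left(\frac{5kd}{\varepsilon_2-\varepsilon_1}\right)^d\right)$. (2) There exists a non-adaptive tolerant tester for $k$-monotonicity of functions $f\colon[n]^d\to\{0,1\}$ with query complexity $q(n,d,\varepsilon_1,\varepsilon_2,k)=2^{\tilde{O}(k\sqrt{d}/(\varepsilon_2-3\varepsilon_1)^2)}$, valid under the restriction $\varepsilon_2>3\varepsilon_1$.
   Context: $[n]^d$ is ordered coordinatewise. A function $f\colon[n]^d\to\{0,1\}$ is $k$-monotone if there do not exist $x_1\preceq\cdots\preceq x_{k+1}$ with $f(x_1)=1$ and $f(x_i)\neq f(x_{i+1})$ for all $i\in[k]$. Distance $\mathrm{dist}(f,g)=\Pr_x[f(x)\neq g(x)]$ for uniform $x\in[n]^d$, and $\mathrm{dist}(f,\mathcal{P})$ is the minimum over $g$ in the property $\mathcal{P}$. A tolerant tester, given $0\leq\varepsilon_1<\varepsilon_2\leq1$ and query access to $f$, outputs ACCEPT with probability at least $2/3$ if $\mathrm{dist}(f,\mathcal{P})\leq\varepsilon_1$ and REJECT with probability at least $2/3$ if $\mathrm{dist}(f,\mathcal{P})\geq\varepsilon_2$; ''fully tolerant'' means this works for every such pair $\varepsilon_1<\varepsilon_2$. Non-adaptive means queries do not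 depend on previous answers. $\tilde{O}$ hides polylogarithmic factors. *)

(* Defs.v *)
From Stdlib Require Import Reals.
From mathcomp Require Import all_boot.
Set Implicit Arguments. Unset Strict Implicit. Unset Printing Implicit Defensive.

Open Scope R_scope.

Definition point (n d : nat) := {ffun 'I_d -> 'I_n}.

Definition pt_le n d (x y : point n d) : Prop := forall i : 'I_d, (x i <= y i)%N.

(* k-monotone: no chain x_0 <= ... <= x_k with f x_0 = 1 and consecutive
   values alternating (paper's x_1..x_{k+1}, shifted to start at 0). *)
Definition kmonotone n d (k : nat) (f : point n d -> bool) : Prop :=
  ~ exists x : nat -> point n d,
      f (x 0%N) = true /\
      forall i : nat, (i < k)%N -> pt_le (x i) (x i.+1) /\ f (x i) <> f (x i.+1).

Definition dist n d (f g : point n d -> bool) : R :=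
  INR #|[pred x | f x != g x]| / INR #|{: point n d}|.

(* dist(f,P) = min_{g in P} dist(f,g); the domain is finite, so the min is
   attained (P nonempty here), and the two threshold conditions unfold to: *)
Definition dist_to_le n d (P : (point n d -> bool) -> Prop) f (e : R) : Prop :=
  exists g, P g /\ dist f g <= e.
Definition dist_to_ge n d (P : (point n d -> bool) -> Prop) f (e : R) : Prop :=
  forall g, P g -> e <= dist f g.

(* A non-adaptive randomized query algorithm: a finite probability
   distribution over pairs (query sequence, decision rule on the answers).
   Each outcome is (weight, (queries, decision)); decision true = ACCEPT. *)
Definition ntester n d :=
  seq (R * (seq (point n d) * (seq bool -> bool))).

Definition valid_tester n d (T : ntester n d) : Prop :=
  (forall o, List.In o T -> 0 <= o.1) /\
  foldr (fun o s => o.1 + s) 0 T = 1.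

Definition accept_prob n d (T : ntester n d) (f : point n d -> bool) : R :=
  foldr (fun o s => o.1 * (if o.2.2 (map f o.2.1) then 1 else 0) + s) 0 T.

Definition query_bound n d (T : ntester n d) (q : R) : Prop :=
  forall o, List.In o T -> INR (size o.2.1) <= q.

Definition tolerant_tester n d (P : (point n d -> bool) -> Prop)
    (T : ntester n d) (e1 e2 : R) : Prop :=
  forall f : point n d -> bool,
    (dist_to_le P f e1 -> 2/3 <= accept_prob T f) /\
    (dist_to_ge P f e2 -> 1 - accept_prob T f >= 2/3).

Definition bound1 (d k : nat) (e1 e2 : R) : R :=
  (1 / (e2 - e1) ^ 2) * ((5 * INR k * INR d) / (e2 - e1)) ^ d.
Definition bound2 (d k : nat) (e1 e2 : R) : R :=
  INR k * sqrt (INR d) / (e2 - 3 * e1) ^ 2.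

(* Main.v *)
(** A k-monotone f is the parity of a monotone level function L with values in
    {0, ..., k}: L x is the length of the longest alternating chain below x that
    starts at value 1.  Everything follows from two consequences of this.

    Coarsening.  Cut the domain into m^d blocks.  Along a diagonal the
    oscillations of L over the blocks telescope, so at most k d m^(d-1) blocks
    are non-constant for f, and f is within k d / m of a k-monotone function on
    [m]^d.

    Low degree.  The variance of f along a line is at most the correlation of L
    with a fixed centered function of one coordinate; summing over the d
    coordinates bounds the total influence of f by k sqrt(d).  Hence, up to an
    error O(k sqrt(d) / t), f on [m]^d is determined by its (rounded) averages
    over the subcubes fixing fewer than t coordinates.

    Both give finite nets of k-monotone functions, of size 2^(m^d) in the first
    case and, in the second, exponential only in the number (d m + 1)^(t - 1) of
    subcubes.  The tester samples uniform points and accepts if some function of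
    the net is empirically close to f; by a Chernoff bound, O(log N / gamma^2)
    samples suffice for a net of size N and a gap gamma. *)
Require Import Defs.
From Stdlib Require Import Reals ZArith Classical Lra Psatz.
Ltac Rring := ring.
Ltac Rfield := field.
Ltac Rlra := lra.
Ltac Rnra := nra.
From mathcomp Require Import all_boot all_order all_algebra.
From mathcomp Require Import zify ring lra Rstruct.
Set Implicit Arguments. Unset Strict Implicit. Unset Printing Implicit Defensive.
Open Scope R_scope.

(** * Levels of k-monotone functions *)

Section Levels.
Local Open Scope nat_scope.
Variables (n d : nat) (f : point n d -> bool).

Definition pt_leb (x y : point n d) := [forall i, x i <= y i].

Lemma pt_leP x y : reflect (pt_le x y) (pt_leb x y).
Proof. exact: forallP. Qed.

Lemma pt_le_refl (x : point n d) : pt_le x x.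
Proof. by move=> i. Qed.

Lemma pt_le_trans (x y z : point n d) : pt_le x y -> pt_le y z -> pt_le x z.
Proof. by move=> xy yz i; apply: leq_trans (xy i) (yz i). Qed.

(** The chain is peeled from its top: element number [j] from the bottom has value [odd j], so the
    lowest one has value 1. *)
Fixpoint alternating_below (j : nat) (x : point n d) : bool :=
  if j is j'.+1 then
    [exists y, [&& pt_leb y x, f y == odd j & alternating_below j' y]]
  else true.

Lemma alternating_below_le j x y :
  pt_le x y -> alternating_below j x -> alternating_below j y.
Proof.
case: j => [//|j] xy /existsP[z /and3P[/pt_leP zx fz az]].
apply/existsP; exists z; apply/and3P; split=> //.
by apply/pt_leP; apply: pt_le_trans xy.
Qed.

Lemma alternating_below_pred j x :
  alternating_below j.+1 x -> alternating_below j x.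
Proof.
by case/existsP=> y /and3P[/pt_leP yx _]; apply: alternating_below_le.
Qed.

Lemma alternating_below_leq i j x :
  i <= j -> alternating_below j x -> alternating_below i x.
Proof.
elim: j => [|j IHj]; first by rewrite leqn0 => /eqP->.
rewrite leq_eqVlt => /predU1P[->//|]; rewrite ltnS => ij /alternating_below_pred.
exact: IHj.
Qed.

Lemma alternating_below_chain j x : alternating_below j x ->
  exists z : nat -> point n d,
    [/\ forall i, i < j -> f (z i) = odd i.+1,
        forall i, i.+1 < j -> pt_le (z i) (z i.+1)
      & 0 < j -> pt_le (z j.-1) x].
Proof.
elim: j x => [|j IHj] x; first by exists (fun=> x).
case/existsP=> y /and3P[/pt_leP yx /eqP fy /IHj[z [zf zle zy]]].
(* Index [j] holds the new top [y]; later indices repeat it and are unconstrained. *)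
exists (fun i => if i < j then z i else y); split=> [i|i|_] /=.
- rewrite ltnS leq_eqVlt => /predU1P[->|ij]; first by rewrite ltnn fy.
  by rewrite ij zf.
- rewrite ltnS => ij; rewrite ij; case: ltnP => ij'; first exact: zle.
  have -> : i = j.-1 by lia.
  by apply: zy; lia.
- by rewrite ltnn.
Qed.

(** [L x] is the largest [j] with [alternating_below j x]. If [f x] had the wrong parity, [x] itself
    could be put on top of a longest chain, against maximality. *)
Lemma kmonotone_level k : kmonotone k f ->
  exists L : point n d -> nat,
    [/\ forall x y, pt_le x y -> L x <= L y,
        forall x, L x <= k
      & forall x, f x = odd (L x)].
Proof.
move=> fk.
have no_chain x : ~~ alternating_below k.+1 x.
  apply/negP => /alternating_below_chain[z [zf zle _]].
  apply: fk; exists z; split; first exact: zf.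
  move=> i ik; split; first by apply: zle; rewrite ltnS.
  by rewrite !zf ?ltnS // 1?ltnW //=; case: (odd i).
have ub x j : alternating_below j x -> j <= k.
  rewrite leqNgt => aj; apply/negP => kj.
  by case/negP: (no_chain x); apply: alternating_below_leq aj.
have ex0 x : exists j, alternating_below j x by exists 0.
exists (fun x => ex_maxn (ex0 x) (ub x)); split=> [x y xy|x|x].
- case: ex_maxnP => i ai _; case: ex_maxnP => j _; apply.
  exact: alternating_below_le ai.
- by case: ex_maxnP => i ai _; apply: ub ai.
- case: ex_maxnP => i ai max_i; apply/eqP/negPn/negP => fx.
  suff /max_i : alternating_below i.+1 x by rewrite ltnn.
  apply/existsP; exists x; apply/and3P; split=> //; first exact/pt_leP/pt_le_refl.
  by rewrite /=; case: (f x) (odd i) fx => [] [].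
Qed.

End Levels.

(** * Resampling a coordinate and coarsening the grid *)

Lemma pred_ltn (n : nat) : (0 < n -> n.-1 < n)%N.
Proof. by rewrite ltn_predL. Qed.

Section Resampling.
Variables (m d : nat).

Definition upd (x : point m d) (i : 'I_d) (a : 'I_m) : point m d :=
  [ffun j => if j == i then a else x j].

Lemma upd_same x i a : upd x i a i = a.
Proof. by rewrite ffunE eqxx. Qed.

Lemma upd_upd x i a b : upd (upd x i a) i b = upd x i b.
Proof. by apply/ffunP => j; rewrite !ffunE; case: eqP. Qed.

Lemma upd_id x i : upd x i (x i) = x.
Proof. by apply/ffunP => j; rewrite !ffunE; case: eqP => [->|]. Qed.

Lemma updC x i j a b : i != j -> upd (upd x i a) j b = upd (upd x j b) i a.
Proof.
move=> ij; apply/ffunP => l; rewrite !ffunE.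
by case: (eqVneq l j) => [->|]//; rewrite eq_sym (negbTE ij).
Qed.

(** Exchanging the old value of coordinate [i] with the resampled one is an involution on the pairs
    [(x, a)]. *)
Lemma big_resample (T : Type) (idx : T) (op : Monoid.com_law idx) i
    (G : point m d -> T) :
  \big[op/idx]_x \big[op/idx]_a G (upd x i a) =
  \big[op/idx]_x \big[op/idx]_(a < m) G x.
Proof.
pose swap (p : point m d * 'I_m) := (upd p.1 i p.2, p.1 i).
have swapK : involutive swap.
  by case=> x a; rewrite /swap /= upd_same upd_upd upd_id.
rewrite !pair_big /= [RHS](reindex swap) //=.
by exists swap => p _; apply: swapK.
Qed.

End Resampling.

(** * Coarsening through a common refinement of the two grids *)

Section Coarsening.
Local Open Scope nat_scope.
Variables (n m d : nat).
Hypotheses (n_gt0 : 0 < n) (m_gt0 : 0 < m).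

(* [n] and [m] are cut into the same n * m cells: cell number b * n + c is the
   c-th cell of block b of [m], and lies above the point (b * n + c) / m of [n]. *)
Lemma refine_subproof (b : 'I_m) (c : 'I_n) : (b * n + c) %/ m < n.
Proof.
rewrite ltn_divLR //; apply: (@leq_trans (b * n + n)); first by rewrite ltn_add2l.
by rewrite -mulSnr mulnC leq_mul2l ltn_ord orbT.
Qed.

Definition refine (b : point m d) (c : point n d) : point n d :=
  [ffun i => Ordinal (refine_subproof (b i) (c i))].

Definition zero_pt : point n d := [ffun=> Ordinal n_gt0].
Definition last_pt : point n d := [ffun=> Ordinal (pred_ltn n_gt0)].

(** Sampling each block at its lowest cell makes the coarse function a pullback of [f] along a
    monotone map, so k-monotonicity is inherited. *)
Definition coarsen (f : point n d -> bool) (b : point m d) := f (refine b zero_pt).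

Lemma refine_le b b' c c' :
  pt_le b b' -> pt_le c c' -> pt_le (refine b c) (refine b' c').
Proof.
move=> bb cc i; rewrite !ffunE /=; apply: leq_div2r.
by rewrite leq_add ?cc // leq_mul2r bb orbT.
Qed.

Lemma zero_ptP c : pt_le zero_pt c.
Proof. by move=> i; rewrite ffunE. Qed.

Lemma last_ptP c : pt_le c last_pt.
Proof. by move=> i; rewrite ffunE /= -ltnS prednK. Qed.

Lemma kmonotone_coarsen k f : kmonotone k f -> kmonotone k (coarsen f).
Proof.
move=> fk [x [x0 alt]]; apply: fk; exists (fun i => refine (x i) zero_pt).
split=> // i /alt[xle xf]; split=> //.
by apply: refine_le => //; apply: pt_le_refl.
Qed.

(** In each coordinate, the quotient and remainder by [m] of the cell number [b * n + c]. As (block,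
    offset) and (point, remainder) name the same cells, every point of the fine grid is hit by
    exactly [m ^ d] pairs, even when [m] does not divide [n]. *)
Definition regrid (p : point m d * point n d) : point n d * point m d :=
  (refine p.1 p.2, [ffun i => Ordinal (ltn_pmod (p.1 i * n + p.2 i) m_gt0)]).

Lemma regrid_inj : injective regrid.
Proof.
move=> [b c] [b' c'] [/ffunP eqq /ffunP eqr].
have eqx i : b i * n + c i = b' i * n + c' i.
  have := eqq i; have := eqr i; rewrite !ffunE => -[er] [eq].
  by rewrite (divn_eq (b i * n + c i) m) (divn_eq (b' i * n + c' i) m) er eq.
have eqb i : b i = b' i :> nat.
  have := congr1 (divn^~ n) (eqx i).
  by rewrite !divnMDl // !divn_small // !addn0.
have eqc i : c i = c' i :> nat by have := eqx i; rewrite eqb => /addnI.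
congr (_, _); apply/ffunP => i; apply/val_inj.
  exact: eqb.
exact: eqc.
Qed.

Lemma regrid_bij : bijective regrid.
Proof. by apply: inj_card_bij regrid_inj _; rewrite !card_prod mulnC. Qed.


Lemma sum_refine (F : point n d -> nat) :
  \sum_b \sum_c F (refine b c) = m ^ d * \sum_y F y.
Proof.
rewrite pair_big /= (eq_bigr (fun p => F (regrid p).1)) //.
transitivity (\sum_(q : point n d * point m d) F q.1).
  by rewrite [RHS](reindex regrid) //; apply/onW_bij/regrid_bij.
rewrite -(pair_bigA _ (fun y (_ : point m d) => F y)) /= big_distrr /=.
by apply: eq_bigr => y _; rewrite sum_nat_const card_ffun !card_ord.
Qed.

Lemma sum_hyperplane (i : 'I_d) (a : 'I_m) :
  m * \sum_(b : point m d) (b i == a) = m ^ d.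
Proof.
have := big_resample addn i (fun b : point m d => nat_of_bool (b i == a)).
under [RHS]eq_bigr do rewrite sum_nat_const card_ord.
rewrite -big_distrr /= => <-.
under eq_bigr => b _.
  under eq_bigr do rewrite upd_same.
  rewrite (bigD1 a) //= eqxx big1 ?addn0; last by move=> c /negbTE->.
  over.
by rewrite sum_nat_const card_ffun !card_ord muln1.
Qed.

(** Taking the successor cyclically makes the diagonal step a permutation of the blocks; it wraps
    around only at blocks with some coordinate equal to [m.-1]. *)
Definition next (b : point m d) : point m d := [ffun i => ordS (b i)].

Lemma next_bij : bijective next.
Proof.
exists (fun b : point m d => [ffun i => ord_pred (b i)] : point m d) => b;
  by apply/ffunP => i; rewrite !ffunE (ordSK, ord_predK).
Qed.

(* Along each diagonal the blocks are totally ordered, so the oscillations of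
   [L] over them telescope; only blocks on the upper boundary are left over. *)
Lemma sum_block_oscillation (L : point n d -> nat) k :
    (forall x y, pt_le x y -> L x <= L y) -> (forall x, L x <= k) ->
  m * \sum_b L (refine b last_pt) <=
  m * \sum_b L (refine b zero_pt) + k * d * m ^ d.
Proof.
move=> Lle Lk.
rewrite (reindex next (F := fun b => L (refine b zero_pt))) /=; last first.
  exact/onW_bij/next_bij.
pose top : 'I_m := Ordinal (pred_ltn m_gt0).
(* A block with no coordinate at the top ends at or below the start of its diagonal successor. Any
   other block is charged [k] for each of its top coordinates. *)
apply: (@leq_trans (m * \sum_b (L (refine (next b) zero_pt) +
                                k * \sum_(i < d) (b i == top)))).
  rewrite leq_mul2l; apply/orP; right; apply: leq_sum => b _.
  case: (boolP [exists i, b i == top]) => [/existsP[i bi]|].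
    rewrite (bigD1 i) //= bi; apply: leq_trans (Lk _) _.
    by rewrite mulnDr muln1 addnA -addnA addnCA leq_addr.
  rewrite negb_exists => /forallP nb.
  rewrite (leq_trans _ (leq_addr _ _)) //; apply: Lle => i; rewrite !ffunE /=.
  have bi : (b i).+1 < m.
    have := nb i; rewrite -val_eqE /=; have := ltn_ord (b i); lia.
  rewrite (modn_small bi) addn0; apply: leq_div2r; rewrite mulSn; lia.
rewrite big_split mulnDr leq_add2l -big_distrr /= mulnCA -mulnA leq_mul2l.
apply/orP; right; rewrite exchange_big big_distrr /=.
under eq_bigr do rewrite sum_hyperplane.
by rewrite sum_nat_const card_ord.
Qed.

(** After division by [m * m ^ d * n ^ d], passing to the coarse grid costs at most [2 * k * d / m]
    in distance. On a block where neither level function oscillates, [f] and [g] are constant, so a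
    mismatch is already visible at the lowest cell; any other block is paid for by its oscillation,
    which is at least 1. *)
Lemma coarsen_mismatch k f g : kmonotone k f -> kmonotone k g ->
  m * (m ^ d * \sum_y (f y != g y)) <=
  n ^ d * (2 * (k * d * m ^ d) + m * \sum_b (coarsen f b != coarsen g b)).
Proof.
move=> /kmonotone_level[F [Fle Fk fF]] /kmonotone_level[G [Gle Gk gG]].
pose osc L b := L (refine b last_pt) - L (refine b zero_pt).
have le_zl b : pt_le (refine b zero_pt) (refine b last_pt).
  by apply: refine_le; [apply: pt_le_refl | apply: zero_ptP].
have sum_osc (L : point n d -> nat) : (forall x y, pt_le x y -> L x <= L y) ->
    (forall x, L x <= k) -> m * \sum_b osc L b <= k * d * m ^ d.
  move=> Lle Lk; have le_osc := sum_block_oscillation Lle Lk.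
  rewrite -(leq_add2l (m * \sum_b L (refine b zero_pt))) -mulnDr -big_split /=.
  have -> // : \sum_b (L (refine b zero_pt) + osc L b) = \sum_b L (refine b last_pt).
  by apply: eq_bigr => b _; rewrite /osc subnKC // Lle.
have const (L : point n d -> nat) b c : (forall x y, pt_le x y -> L x <= L y) ->
    osc L b = 0 -> L (refine b c) = L (refine b zero_pt).
  move=> Lle /eqP; rewrite subn_eq0 => le_lz.
  apply/eqP; rewrite eqn_leq (leq_trans _ le_lz) /=; apply: Lle.
    by apply: refine_le; [apply: pt_le_refl | apply: zero_ptP].
  by apply: refine_le; [apply: pt_le_refl | apply: last_ptP].
apply: (@leq_trans (m * \sum_b \sum_(c : point n d)
    (osc F b + osc G b + (coarsen f b != coarsen g b)))).
  rewrite -sum_refine leq_mul2l; apply/orP; right.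
  apply: leq_sum => b _; apply: leq_sum => c _.
  case: (posnP (osc F b)) => [F0|]; last by case: (_ != _); lia.
  case: (posnP (osc G b)) => [G0|]; last by case: (_ != _); lia.
  by rewrite F0 G0 /coarsen !fF !gG (const F) // (const G).
under eq_bigr do rewrite sum_nat_const card_ffun !card_ord.
rewrite -big_distrr /= mulnCA leq_mul2l; apply/orP; right.
rewrite !big_split /= !mulnDr leq_add2r mul2n -addnn.
by rewrite leq_add // sum_osc.
Qed.

End Coarsening.

(** * Total influence and low-degree averages *)

Section LowDegree.
Import Order.TTheory GRing.Theory Num.Theory.
Local Open Scope ring_scope.
Variables (R : realFieldType) (m d : nat).
Hypothesis m_gt0 : (0 < m)%N.
Local Notation X := (point m d).
Implicit Types (F G : X -> R) (i j : 'I_d) (x y : X).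

Let m_neq0 : m%:R != 0 :> R. Proof. by rewrite pnatr_eq0 -lt0n. Qed.

(** The conditional expectation given all coordinates but [i], that is, the orthogonal projection
    onto functions that ignore coordinate [i]. *)
Definition avg i F x : R := (\sum_a F (upd x i a)) / m%:R.

Lemma eq_avg i F G : F =1 G -> avg i F =1 avg i G.
Proof. by move=> FG x; congr (_ / _); apply: eq_bigr. Qed.

Lemma sum_avg i F : \sum_x avg i F x = \sum_x F x.
Proof.
rewrite -mulr_suml big_resample.
under eq_bigr do rewrite sumr_const card_ord -mulr_natr.
by rewrite -mulr_suml mulfK.
Qed.

Lemma avg_upd i F x a : avg i F (upd x i a) = avg i F x.
Proof. by congr (_ / _); apply: eq_bigr => b _; rewrite upd_upd. Qed.

Lemma avgB i F G x : avg i (fun y => F y - G y) x = avg i F x - avg i G x.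
Proof. by rewrite /avg sumrB mulrBl. Qed.

Lemma avgC i j F x : avg i (avg j F) x = avg j (avg i F) x.
Proof.
have [->//|ij] := eqVneq i j.
rewrite /avg -!mulr_suml exchange_big /=; congr (_ / _ / _).
by apply: eq_bigr => b _; apply: eq_bigr => a _; rewrite updC.
Qed.

(** Pythagoras: [avg i F] ignores coordinate [i], so it is orthogonal to [F - avg i F]. *)
Lemma sum_sqr_avg i F :
  \sum_x F x ^+ 2 = \sum_x avg i F x ^+ 2 + \sum_x (F x - avg i F x) ^+ 2.
Proof.
have cross : \sum_x F x * avg i F x = \sum_x avg i F x ^+ 2.
  rewrite -(sum_avg i (fun x => F x * avg i F x)).
  apply: eq_bigr => x _; rewrite {1}/avg.
  by under eq_bigr do rewrite avg_upd; rewrite -mulr_suml mulrAC.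
rewrite (eq_bigr (fun x => avg i F x ^+ 2 + (F x - avg i F x) ^+ 2
   + 2 * (F x * avg i F x - avg i F x ^+ 2))); last by move=> x _; ring.
by rewrite !big_split /= -mulr_sumr sumrB cross subrr mulr0 addr0.
Qed.

Definition avgs (l : seq 'I_d) F : X -> R := foldl (fun G i => avg i G) F l.

Lemma eq_avgs l F G : F =1 G -> avgs l F =1 avgs l G.
Proof. by elim: l F G => [//|i l IHl] F G FG; apply/IHl/eq_avg. Qed.

Lemma avgsB l F G x : avgs l (fun y => F y - G y) x = avgs l F x - avgs l G x.
Proof.
elim: l F G => [//|i l IHl] F G /=; rewrite -IHl.
by apply: eq_avgs => y; apply: avgB.
Qed.

Lemma avgs_eq_off l F x y :
  {in [predC l], forall i, x i = y i} -> avgs l F x = avgs l F y.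
Proof.
elim/last_ind: l x y => [|l i IHl] x y xy.
  by congr F; apply/ffunP => i; apply: xy.
rewrite /avgs foldl_rcons -/(avgs l F); congr (_ / _); apply: eq_bigr => a _.
apply: IHl => j jl; rewrite !ffunE; case: eqP => // /eqP ji; apply: xy.
by rewrite !inE mem_rcons inE (negbTE ji).
Qed.

(* Induction on the coordinates [l] still to be averaged: split F into its
   average over the next coordinate, and the rest, which has one degree less to
   spend; both pieces are orthogonal, and so are the pieces of each F - avg j F. *)
Lemma sum_sqr_low_degree (l : seq 'I_d) (t : nat) F (eta : R) :
    uniq l -> 0 <= eta ->
    (forall S : {set 'I_d}, (count (mem S) l < t)%N ->
       forall x, `|avgs [seq i <- l | i \notin S] F x| <= eta) ->
  t%:R * \sum_x F x ^+ 2 <=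
  t%:R * 5 ^+ size l * eta ^+ 2 * #|X|%:R
  + \sum_(i <- l) \sum_x (F x - avg i F x) ^+ 2.
Proof.
case: t => [|t].
  by rewrite !mul0r add0r => *; do 2!apply: sumr_ge0 => ? _; apply: sqr_ge0.
elim: l t F eta => [|i l IHl] t F eta.
  move=> _ eta0 small; rewrite big_nil addr0 mulr1 -mulrA ler_wpM2l //.
  rewrite mulr_natr -sumr_const; apply: ler_sum => x _.
  rewrite -real_normK ?num_real // lerXn2r ?nnegrE //.
  by have := small set0 isT x.
move=> /= /andP[il l_uniq] eta0 small.
pose A := avg i F; pose G x := F x - A x.
have split_dev : \sum_(j <- l) \sum_x (F x - avg j F x) ^+ 2 =
    \sum_(j <- l) \sum_x (A x - avg j A x) ^+ 2 +
    \sum_(j <- l) \sum_x (G x - avg j G x) ^+ 2.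
  rewrite -big_split; apply: eq_bigr => j _.
  rewrite (sum_sqr_avg i); congr (_ + _); apply: eq_bigr => x _.
    by rewrite avgB avgC.
  by rewrite /G !avgB /= avgC; congr (_ ^+ 2); rewrite /A; ring.
have il_neq j : j \in l -> j != i by apply: contraTneq => ->.
(* Averages of [A] are averages of [F] with [i] left free, which costs no fixed coordinate. *)
have smallA (S : {set 'I_d}) : (count (mem S) l < t.+1)%N ->
    forall x, `|avgs [seq j <- l | j \notin S] A x| <= eta.
  move=> cS x; have := small (S :\ i) _ x.
  rewrite !inE eqxx /= (@eq_in_filter _ _ [pred j | j \notin S]); last first.
    by move=> j jl; rewrite !inE il_neq.
  apply; rewrite add0n; apply: leq_ltn_trans cS; apply: sub_count => j.
  by rewrite !inE => /andP[].
(* Here [i] is fixed as well and uses up one coordinate. Hence [G], the difference of [F] and [A],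
   is controlled with budget [t] and bound [2 * eta]. *)
have smallF (S : {set 'I_d}) : (count (mem S) l < t)%N ->
    forall x, `|avgs [seq j <- l | j \notin S] F x| <= eta.
  move=> cS x; have := small (i |: S) _ x.
  rewrite !inE eqxx /= (@eq_in_filter _ _ [pred j | j \notin S]); last first.
    by move=> j jl; rewrite !inE (negbTE (il_neq _ jl)).
  apply; rewrite add1n ltnS (@eq_in_count _ _ (mem S)) // => j jl.
  by rewrite !inE (negbTE (il_neq _ jl)).
have dev_ge0 (H : X -> R) : 0 <= \sum_(j <- l) \sum_x (H x - avg j H x) ^+ 2.
  by do 2!apply: sumr_ge0 => ? _; apply: sqr_ge0.
have lowA := IHl t A eta l_uniq eta0 smallA.
have lowG : t%:R * \sum_x G x ^+ 2 <= t%:R * 5 ^+ size l * (2 * eta) ^+ 2 * #|X|%:R +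
    \sum_(j <- l) \sum_x (G x - avg j G x) ^+ 2.
  case: (t) smallA smallF => [|t'] smallA smallF.
    by rewrite !mul0r add0r.
  apply: IHl => // [|S cS x]; first by rewrite mulr_ge0.
  rewrite avgsB (le_trans (ler_normB _ _)) // (_ : 2 * eta = eta + eta); last by ring.
  by apply: lerD; [apply: smallF | apply: smallA; apply: ltnW].
rewrite big_cons split_dev (sum_sqr_avg i) exprS -natr1.
rewrite -natr1 in lowA.
have Q0 : 0 <= 5 ^+ size l * eta ^+ 2 * #|X|%:R by rewrite !mulr_ge0 ?exprn_ge0 ?sqr_ge0.
rewrite -/A -/G.
have t0 : 0 <= t%:R :> R by [].
move: lowA lowG Q0 t0; rewrite -/(G _).
set a := \sum_x A x ^+ 2.
set g := \sum_x (F x - A x) ^+ 2.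
set P := 5 ^+ size l; set N := #|X|%:R; set T := t%:R.
set IA := \sum_(j <- l) _; set IG := \sum_(j <- l) _.
move=> lowA lowG Q0 t0.
(* The base 5 is 1 + 4: [A] has bound [eta ^+ 2], [G] has bound [4 * eta ^+ 2]. The one extra [g] on
   the left is exactly the deviation of [F] in coordinate [i]. *)
have -> : (T + 1) * (5 * P) * eta ^+ 2 * N =
   (T + 1) * P * eta ^+ 2 * N + T * P * (2 * eta) ^+ 2 * N + 4 * (P * eta ^+ 2 * N) by ring.
have -> : (T + 1) * (a + g) = (T + 1) * a + T * g + g by ring.
lra.
Qed.

(** The mean sign of [a - b] over [b], equal to the centered rank [(2 * a - m + 1) / m]. *)
Definition cmp_avg (a : 'I_m) : R := (\sum_(b < m) (((b < a)%N)%:R - ((a < b)%N)%:R)) / m%:R.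

Lemma cmp_avg_norm a : `|cmp_avg a| <= 1.
Proof.
rewrite normrM normfV [`|m%:R|]ger0_norm // ler_pdivrMr ?ltr0n // mul1r.
apply: le_trans (ler_norm_sum _ _ _) _.
rewrite -[X in _ <= X%:R]card_ord -sumr_const; apply: ler_sum => b _.
by case: ltngtP => _; rewrite ?subr0 ?sub0r ?normrN ?normr1 ?normr0.
Qed.

Lemma sum_cmp_avg : \sum_a cmp_avg a = 0.
Proof.
rewrite -mulr_suml; under eq_bigr do rewrite sumrB.
by rewrite sumrB [X in _ - X]exchange_big subrr mul0r.
Qed.

(** The sum of squared deviations is the sum of squared pairwise differences over [2 * m]. Those are
    at most [|L a - L b|], a signed difference because [L] is monotone, and collecting the
    coefficient of each [L a] produces [cmp_avg a]. *)
Lemma line_variance (u L : 'I_m -> R) :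
    (forall a b : 'I_m, (a <= b)%N -> L a <= L b) ->
    (forall a b, (u a - u b) ^+ 2 <= `|L a - L b|) ->
  \sum_a (u a - (\sum_b u b) / m%:R) ^+ 2 <= \sum_a L a * cmp_avg a.
Proof.
move=> Lle uL.
have var : \sum_a (u a - (\sum_b u b) / m%:R) ^+ 2 =
    (\sum_a \sum_b (u a - u b) ^+ 2) / (2 * m%:R).
  set s := \sum_b u b; set q := \sum_b u b ^+ 2.
  have -> : \sum_a \sum_b (u a - u b) ^+ 2 = 2 * (m%:R * q - s ^+ 2).
    rewrite (eq_bigr (fun a => u a ^+ 2 * m%:R + q - 2 * s * u a)); last first.
      move=> a _; rewrite (eq_bigr (fun b => u a ^+ 2 + u b ^+ 2 - 2 * u a * u b)).
        by rewrite sumrB big_split /= sumr_const card_ord -mulr_sumr -[_ *+ m]mulr_natr -/q -/s;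
          ring.
      by move=> b _; ring.
    by rewrite sumrB big_split /= sumr_const card_ord -!mulr_sumr -!mulr_suml
      -[_ *+ m]mulr_natr -/q -/s;
          ring.
  rewrite (eq_bigr (fun a => u a ^+ 2 + (s / m%:R) ^+ 2 - 2 * (s / m%:R) * u a)).
    by rewrite sumrB big_split /= sumr_const card_ord -mulr_sumr -[_ *+ m]mulr_natr
      -/s -/q; field.
  by move=> a _; ring.
have normL : \sum_a \sum_b `|L a - L b| = 2 * m%:R * \sum_a L a * cmp_avg a.
  rewrite (eq_bigr (fun a => \sum_(b < m) L a * (((b < a)%N)%:R - ((a < b)%N)%:R) -
     \sum_(b < m) L b * (((b < a)%N)%:R - ((a < b)%N)%:R))); last first.
    move=> a _; rewrite -sumrB; apply: eq_bigr => b _.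
    case: (ltngtP b a) => [ba|ab|/val_inj->].
    - by rewrite ger0_norm ?subr_ge0 ?Lle 1?ltnW // subr0 !mulr1.
    - by rewrite ler0_norm ?subr_le0 ?Lle 1?ltnW //= mulr0n mulr1n; ring.
    - by rewrite !subrr normr0.
  rewrite sumrB [X in _ - X]exchange_big /= -sumrB mulr_sumr; apply: eq_bigr => a _.
  rewrite -!mulr_sumr /cmp_avg !sumrB; field.
  exact: m_neq0.
rewrite var ler_pdivrMr ?mulr_gt0 ?ltr0n // mulrC -normL.
by apply: ler_sum => a _; apply: ler_sum => b _.
Qed.

(** Centered functions of distinct coordinates are orthogonal, so only the [d] diagonal terms
    survive. This is the source of the square root of [d]. *)
Lemma sum_sqr_cmp_avg :
  \sum_(x : X) (\sum_i cmp_avg (x i)) ^+ 2 <= d%:R * #|X|%:R.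
Proof.
have cross i j : i != j -> \sum_(x : X) cmp_avg (x i) * cmp_avg (x j) = 0.
  move=> ij; rewrite -(sum_avg i) big1 // => x _; rewrite /avg.
  under eq_bigr do rewrite upd_same ffunE eq_sym (negbTE ij).
  by rewrite -mulr_suml sum_cmp_avg !mul0r.
have -> : \sum_(x : X) (\sum_i cmp_avg (x i)) ^+ 2 =
    \sum_i \sum_(x : X) cmp_avg (x i) ^+ 2.
  under eq_bigr do rewrite expr2 big_distrl /=.
  rewrite exchange_big; apply: eq_bigr => i _.
  under eq_bigr do rewrite big_distrr /=.
  by rewrite exchange_big (bigD1 i) //= [X in _ + X]big1 ?addr0 // => j;
    rewrite eq_sym; exact: cross.
rewrite mulr_natl -[X in _ *+ X]card_ord -sumr_const; apply: ler_sum => i _.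
rewrite -[leRHS]sumr_const; apply: ler_sum => x _.
by rewrite -real_normK ?num_real // expr_le1 ?cmp_avg_norm.
Qed.

(** Summing the line bounds correlates [L] with the sum of all [cmp_avg (x i)], whose mean absolute
    value is at most [sigma]. The parameter [sigma] stands in for the square root of [d], which an
    arbitrary real field need not contain. *)
Lemma total_influence (h L : X -> R) (K sigma : R) :
    (forall x y, pt_le x y -> L x <= L y) -> (forall x, `|L x| <= K) ->
    (forall x y, (h x - h y) ^+ 2 <= `|L x - L y|) ->
    0 < sigma -> d%:R <= sigma ^+ 2 ->
  \sum_i \sum_x (h x - avg i h x) ^+ 2 <= K * sigma * #|X|%:R.
Proof.
move=> Lle LK hL s0 ds.
have upd_le x i (a b : 'I_m) : (a <= b)%N -> pt_le (upd x i a) (upd x i b).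
  by move=> ab j; rewrite !ffunE; case: eqP.
have line i : \sum_x (h x - avg i h x) ^+ 2 <= \sum_(x : X) L x * cmp_avg (x i).
  rewrite -(sum_avg i) -[leRHS](sum_avg i); apply: ler_sum => x _.
  rewrite ler_pM2r ?invr_gt0 ?ltr0n //.
  under eq_bigr do rewrite avg_upd.
  under [leRHS]eq_bigr do rewrite upd_same.
  by apply: line_variance => a b // ab; apply/Lle/upd_le.
apply: le_trans (ler_sum _ (fun i _ => line i)) _.
rewrite exchange_big /=; under eq_bigr do rewrite -mulr_sumr.
have K0 (x : X) : 0 <= K := le_trans (normr_ge0 _) (LK x).
(* AM-GM: [|s| <= (s^2 / sigma + sigma) / 2] *)
apply: (@le_trans _ _ (\sum_(x : X) K * ((\sum_i cmp_avg (x i)) ^+ 2 / sigma + sigma) / 2)).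
  apply: ler_sum => x _; apply: le_trans (ler_norm _) _; rewrite normrM -mulrA.
  apply: ler_pM => //; set s := \sum_i _; rewrite -[s ^+ 2]real_normK ?num_real //.
  rewrite ler_pdivlMr // -subr_ge0.
  have -> : `|s| ^+ 2 / sigma + sigma - `|s| * 2 = (`|s| - sigma) ^+ 2 / sigma.
    by field; rewrite gt_eqF.
  by rewrite divr_ge0 ?sqr_ge0 // ltW.
case: (pickP (@predT X)) => [x0 _|X0]; last first.
  by rewrite big_pred0 // eq_card0 ?mulr0.
rewrite -mulr_suml -mulr_sumr big_split /= -mulr_suml sumr_const -[_ *+ #|_|]mulr_natr.
rewrite ler_pdivrMr // -!mulrA ler_wpM2l ?(K0 x0) //.
have := sum_sqr_cmp_avg; move: (\sum_x _) (#|X|%:R : R) (ler0n R #|X|) => Q N N0 QN.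
have : Q / sigma <= sigma * N.
  rewrite ler_pdivrMr // (le_trans QN) // mulrAC -expr2.
  exact: ler_wpM2r.
by rewrite mulr2n mulrDr mulr1 mulrDr lerD2r.
Qed.

Definition indicator (f : X -> bool) x : R := (f x)%:R.

(** Apply the low-degree bound to the difference of the indicators. Values are parities of levels,
    so a change of value forces the level to change by at least 1, as [total_influence] requires. *)
Lemma kmonotone_low_degree k (f g : X -> bool) (t : nat) (eta sigma : R) :
    kmonotone k f -> kmonotone k g ->
    0 <= eta -> 0 < sigma -> d%:R <= sigma ^+ 2 ->
    (forall S : {set 'I_d}, (#|S| < t)%N -> forall x,
      `|avgs [seq i <- enum 'I_d | i \notin S] (indicator f) x -
        avgs [seq i <- enum 'I_d | i \notin S] (indicator g) x| <= eta) ->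
  t%:R * (\sum_x (f x != g x))%:R <=
  (t%:R * 5 ^+ d * eta ^+ 2 + 4 * k%:R * sigma) * #|X|%:R.
Proof.
move=> fk gk eta0 s0 ds close.
have jump (p q : bool) c : (0 < c)%N -> (p%:R - q%:R) ^+ 2 <= c%:R :> R.
  move=> c0; apply: (@le_trans _ _ 1); last by rewrite ler1n.
  by case: p q => [] [] /=; rewrite ?subrr ?subr0 ?sub0r ?sqrrN ?expr0n ?expr1n ?ler01.
have infl h : kmonotone k h ->
    \sum_i \sum_x (indicator h x - avg i (indicator h) x) ^+ 2 <= k%:R * sigma * #|X|%:R.
  move=> /kmonotone_level[L [Lle Lk hL]].
  apply: (@total_influence _ (fun x => (L x)%:R)) => //.
  - by move=> x y /Lle; rewrite ler_nat.
  - by move=> x; rewrite ger0_norm // ler_nat.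
  - move=> x y; rewrite /indicator !hL; case: (ltngtP (L x) (L y)) => [xy|yx|->].
    + rewrite ler0_norm ?subr_le0 ?ler_nat 1?ltnW // opprB -(natrB R (ltnW xy)).
      by apply: jump; rewrite subn_gt0.
    + rewrite ger0_norm ?subr_ge0 ?ler_nat 1?ltnW // -(natrB R (ltnW yx)).
      by apply: jump; rewrite subn_gt0.
    + by rewrite !subrr normr0 expr0n.
have := @sum_sqr_low_degree (enum 'I_d) t
  (fun x => indicator f x - indicator g x) eta (enum_uniq _) eta0.
rewrite -cardE card_ord => low.
have -> : (\sum_x (f x != g x))%:R = \sum_x (indicator f x - indicator g x) ^+ 2.
  rewrite natr_sum; apply: eq_bigr => x _; rewrite /indicator.
  by case: (f x) (g x) => [] [] /=; ring.
apply: le_trans (low _) _ => [S cS x|].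
  rewrite avgsB; apply: close; apply: leq_trans cS.
  by rewrite ltnS -sum1_card -sum1_count big_enum_cond.
rewrite mulrDl lerD2l big_enum /=.
have := infl f fk; have := infl g gk.
set If := \sum_i \sum_x (indicator f x - _) ^+ 2.
set Ig := \sum_i \sum_x (indicator g x - _) ^+ 2 => lg lf.
(* The square of a difference is at most twice the sum of the squares; with two influences of at
   most [k * sigma] each, this gives the constant 4. *)
apply: (@le_trans _ _ (2 * (If + Ig))); last by lra.
rewrite -big_split mulr_sumr; apply: ler_sum => i _.
rewrite -big_split mulr_sumr; apply: ler_sum => x _ /=.
rewrite avgB -subr_ge0.
set a := indicator f x; set b := indicator g x; set p := avg i _ x; set q := avg i _ x.
have -> : 2 * ((a - p) ^+ 2 + (b - q) ^+ 2) - (a - b - (p - q)) ^+ 2 =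
   (a - p + (b - q)) ^+ 2 by ring.
exact: sqr_ge0.
Qed.

End LowDegree.

(** * Testing from a net by uniform sampling *)

Section Sampling.
Import Order.TTheory GRing.Theory Num.Theory.
Local Open Scope ring_scope.
Local Notation R := Rdefinitions.R.
Local Notation dist := Defs.dist.
Local Arguments exp x%_ring_scope.

(** * Exponential estimates and a Chernoff bound *)

Lemma expR0 : exp 0 = 1.
Proof. exact: exp_0. Qed.

Lemma exp_ge1D (y : R) : 1 + y <= exp y.
Proof.
have [->|/eqP y0] := eqVneq y 0; first by rewrite expR0 addr0.
by apply/RleP/Rlt_le/exp_ineq1.
Qed.

Lemma expD (x y : R) : exp (x + y) = exp x * exp y.
Proof. exact: exp_plus. Qed.

Lemma ler_exp : {homo exp : x y / x <= y}.
Proof.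
move=> x y; rewrite le_eqVlt => /predU1P[->//|/RltP xy].
exact/ltW/RltP/exp_increasing.
Qed.

Lemma exp_gt0 (x : R) : 0 < exp x.
Proof. exact/RltP/exp_pos. Qed.

Local Arguments exp_ge1D y%_ring_scope.
Local Arguments exp_gt0 x%_ring_scope.

(** From [exp (- y) >= 1 - y] one gets [exp y <= 1 / (1 - y)]. The right-hand side times [1 - y] is
    [1 + y ^+ 2 * (1 - 4 * y) / 3], whence the threshold 1/4. *)
Lemma exp_le_quadratic (y : R) : y <= 1 / 4 -> exp y <= 1 + y + 4 / 3 * y ^+ 2.
Proof.
move=> y4; have y1 : 0 < 1 - y by lra.
have : exp y * (1 - y) <= 1.
  rewrite -[leRHS]expR0 -(subrr y) expD ler_wpM2l ?(ltW (exp_gt0 _)) //.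
  exact: exp_ge1D.
rewrite -ler_pdivlMr // => /le_trans; apply.
rewrite ler_pdivrMr //; nra.
Qed.

Lemma exp_sum (I : finType) (y : I -> R) : exp (\sum_i y i) = \prod_i exp (y i).
Proof. exact: (big_morph exp expD expR0). Qed.

Lemma expMn (x : R) s : exp (s%:R * x) = exp x ^+ s.
Proof. by rewrite mulr_natl -[s in LHS]card_ord -sumr_const exp_sum prodr_const card_ord. Qed.

(** Chernoff's method in counting form, with exponential parameter [gamma / 4]. The threshold
    contributes [gamma ^+ 2 / 8] per sample and the moment generating function [gamma ^+ 2 / 12],
    leaving 1/8 - 1/12 = 1/24. *)
Lemma sampling_tail (X : finType) (Y : X -> R) (s : nat) (gamma : R) :
    0 <= gamma <= 1 -> (forall x, `|Y x| <= 1) -> \sum_x Y x <= 0 ->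
  #|[pred t : {ffun 'I_s -> X} | s%:R * gamma / 2 <= \sum_j Y (t j)]|%:R
  <= #|X|%:R ^+ s * exp (- (s%:R * gamma ^+ 2 / 24)).
Proof.
move=> /andP[g0 g1] Y1 Y0; set tail := [pred t | _].
have markov (t : {ffun 'I_s -> X}) :
    (t \in tail)%:R * exp (s%:R * (gamma ^+ 2 / 8)) <= \prod_j exp (gamma / 4 * Y (t j)).
  rewrite -exp_sum -mulr_sumr; case: (boolP (t \in tail)) => [|_].
    rewrite inE mul1r => tl.
    apply: ler_exp; have -> : s%:R * (gamma ^+ 2 / 8) = gamma / 4 * (s%:R * gamma / 2).
      by field.
    by rewrite ler_wpM2l // divr_ge0.
  by rewrite mul0r ltW ?exp_gt0.
have mgf : \sum_x exp (gamma / 4 * Y x) <= #|X|%:R * exp (gamma ^+ 2 / 12).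
  apply: (@le_trans _ _ (\sum_x (1 + gamma / 4 * Y x + gamma ^+ 2 / 12))).
    apply: ler_sum => x _; have := Y1 x; rewrite ler_norml => /andP[y1 y2].
    apply: le_trans (exp_le_quadratic _) _; first by nra.
    rewrite lerD2l; have Y2 : Y x ^+ 2 <= 1 by nra.
    have -> : 4 / 3 * (gamma / 4 * Y x) ^+ 2 = gamma ^+ 2 / 12 * Y x ^+ 2 by field.
    by rewrite -[leRHS]mulr1 ler_wpM2l // divr_ge0 ?sqr_ge0.
  rewrite (eq_bigr (fun x => gamma / 4 * Y x + (1 + gamma ^+ 2 / 12))); last first.
    by move=> x _; ring.
  rewrite big_split /= -mulr_sumr sumr_const -[_ *+ #|_|]mulr_natl -[leRHS]add0r lerD //.
    by rewrite mulr_ge0_le0 // divr_ge0.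
  by rewrite ler_wpM2l // exp_ge1D.
have total : #|tail|%:R * exp (s%:R * (gamma ^+ 2 / 8)) <=
    #|X|%:R ^+ s * exp (s%:R * (gamma ^+ 2 / 12)).
  apply: (@le_trans _ _ ((\sum_x exp (gamma / 4 * Y x)) ^+ s)).
    have -> : (\sum_x exp (gamma / 4 * Y x)) ^+ s =
        \sum_(t : {ffun 'I_s -> X}) \prod_j exp (gamma / 4 * Y (t j)).
      rewrite -(bigA_distr_bigA (fun _ x => exp (gamma / 4 * Y x))) /=.
      by rewrite prodr_const card_ord.
    rewrite -sum1_card natr_sum mulr_suml big_mkcond /=.
    apply: ler_sum => t _; apply: le_trans (markov t).
    by case: (t \in tail); rewrite ?mul0r.
  rewrite expMn -exprMn; apply: lerXn2r; rewrite ?nnegrE ?mulr_ge0 ?(ltW (exp_gt0 _)) //.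
  by apply: sumr_ge0 => x _; apply/ltW/exp_gt0.
rewrite -(ler_pM2r (exp_gt0 (s%:R * (gamma ^+ 2 / 8)))).
apply: le_trans total _.
rewrite -[leRHS]mulrA -expD; apply: ler_wpM2l; first by rewrite exprn_ge0.
by rewrite le_eqVlt; apply/orP; left; apply/eqP; congr exp; field.
Qed.

Lemma distE n d (f g : point n d -> bool) :
  dist f g = (\sum_x (f x != g x))%:R / #|point n d|%:R.
Proof.
rewrite /Defs.dist RdivE !INRE; congr (_%:R / _).
rewrite -sum1_card big_mkcond; apply: eq_bigr => x _; rewrite inE.
by case: (_ != _).
Qed.

Lemma foldr_sum (T : Type) (F : T -> R) (s : seq T) :
  foldr (fun o r => Rplus (F o) r) 0 s = \sum_(o <- s) F o.
Proof. by elim: s => [|o s IHs]; rewrite ?big_nil // big_cons /= IHs. Qed.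

Lemma in_map_seq (S T : Type) (h : S -> T) (s : seq S) y :
  List.In y (map h s) -> exists x, y = h x.
Proof. by elim: s => [//|x s IHs] /= [<-|/IHs//]; exists x. Qed.

(** * The tester attached to a net *)

Section Tester.
Variables (n d s : nat) (net : seq (point n d -> bool)) (theta : R).
Hypothesis n_gt0 : (0 < n)%N.
Local Notation sample := {ffun 'I_s -> point n d}.

(** The rule sees only the answers on [f], but it knows the sample [t], so it evaluates the net
    functions there without queries. *)
Definition accepts (t : sample) (answers : seq bool) : bool :=
  has (fun g => (\sum_(p <- zip answers (map g (codom t))) (p.1 != p.2))%:R
                <= s%:R * theta :> R) net.

Definition net_tester : ntester n d :=
  [seq (((#|point n d|%:R ^+ s)^-1 : R), (codom t, accepts t))
    | t : sample <- enum {: sample}].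

Let N_gt0 : 0 < #|point n d|%:R :> R.
Proof. by rewrite ltr0n card_ffun !card_ord expn_gt0 n_gt0. Qed.

Lemma acceptsE (f : point n d -> bool) (t : sample) : accepts t (map f (codom t)) =
  has (fun g => \sum_j (f (t j) != g (t j))%:R <= s%:R * theta) net.
Proof.
apply: eq_has => g; rewrite zip_map codomE -map_comp big_map big_enum /=.
by rewrite natr_sum.
Qed.

Lemma net_tester_accept_prob f : accept_prob net_tester f =
  #|[pred t : sample | accepts t (map f (codom t))]|%:R / #|point n d|%:R ^+ s.
Proof.
rewrite /accept_prob foldr_sum big_map big_enum /= -mulr_sumr mulrC.
congr (_ * _); rewrite -sum1_card natr_sum [RHS]big_mkcond /=.
by apply: eq_bigr => t _; rewrite inE; case: (accepts _ _).
Qed.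

Lemma card_sample : #|sample| = (#|point n d| ^ s)%N.
Proof. by rewrite [LHS]card_ffun card_ord. Qed.

Lemma net_tester_valid : valid_tester net_tester.
Proof.
split=> [o oT|].
  have [t ->] := in_map_seq oT.
  by apply/RleP; rewrite invr_ge0 exprn_ge0 // ltW.
rewrite foldr_sum big_map big_enum /= sumr_const -[LHS]mulr_natr.
by rewrite card_sample natrX mulVf // expf_neq0 // gt_eqF.
Qed.

Lemma net_tester_queries o : List.In o net_tester -> size o.2.1 = s.
Proof. by move=> oT; have [t ->] := in_map_seq oT; rewrite size_codom card_ord. Qed.

Lemma dist_triangle (f g h : point n d -> bool) : dist f h <= dist f g + dist g h.
Proof.
rewrite !distE -mulrDl ler_pM2r ?invr_gt0 // -natrD ler_nat -big_split.
by apply: leq_sum => x _; case: (f x) (g x) (h x) => [] [] [].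
Qed.

Lemma dist_ge0_le1 (f g : point n d -> bool) : 0 <= dist f g <= 1.
Proof.
rewrite distE divr_ge0 //= ler_pdivrMr // mul1r ler_nat -sum1_card.
by apply: leq_sum => x _; case: (_ != _).
Qed.

Lemma sum_mismatch_dev (f g : point n d -> bool) :
  \sum_x ((f x != g x)%:R - dist f g) = 0.
Proof. by rewrite sumrB sumr_const -natr_sum distE -[X in _ - X]mulr_natr divfK ?subrr //
  gt_eqF. Qed.

Lemma mismatch_dev_norm (f g : point n d -> bool) x : `|(f x != g x)%:R - dist f g| <= 1.
Proof.
have /andP[] := dist_ge0_le1 f g; rewrite ler_norml.
case: (f x != g x); rewrite ?mulr1n ?mulr0n => p0 p1; apply/andP; split; lra.
Qed.

Variable gamma : R.
Hypothesis gamma01 : 0 <= gamma <= 1.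
Let tail := exp (- (s%:R * gamma ^+ 2 / 24)).

Lemma empirical_upper_tail (f g : point n d -> bool) : dist f g + gamma / 2 <= theta ->
  #|[pred t : sample | s%:R * theta < \sum_j (f (t j) != g (t j))%:R]|%:R
  <= #|point n d|%:R ^+ s * tail.
Proof.
move=> fg; apply: le_trans (sampling_tail s gamma01 (mismatch_dev_norm f g) _).
  rewrite ler_nat; apply/subset_leq_card/subsetP => t; rewrite !inE => lt_t.
  rewrite sumrB sumr_const card_ord lerBrDr -[dist _ _ *+ s]mulr_natl.
  apply: le_trans (ltW lt_t).
  by rewrite -mulrA -mulrDr ler_wpM2l // addrC.
by rewrite sum_mismatch_dev.
Qed.

Lemma empirical_lower_tail (f g : point n d -> bool) : theta + gamma / 2 <= dist f g ->
  #|[pred t : sample | \sum_j (f (t j) != g (t j))%:R <= s%:R * theta]|%:R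
  <= #|point n d|%:R ^+ s * tail.
Proof.
move=> fg.
have norm_dev x : `|dist f g - (f x != g x)%:R| <= 1.
  by rewrite distrC mismatch_dev_norm.
apply: le_trans (sampling_tail s gamma01 norm_dev _).
  rewrite ler_nat; apply/subset_leq_card/subsetP => t; rewrite !inE => le_t.
  rewrite sumrB sumr_const card_ord -[dist _ _ *+ s]mulr_natl lerBrDr.
  apply: le_trans (lerD (lexx _) le_t) _.
  by rewrite -mulrA -mulrDr ler_wpM2l // addrC.
by rewrite sumrB -opprB -sumrB sum_mismatch_dev oppr0.
Qed.

Lemma card_has_le (T : finType) (U : Type) (a : T -> U -> bool) (l : seq U) (c : R) :
    (forall u, List.In u l -> #|[pred t | a t u]|%:R <= c) ->
  #|[pred t | has (a t) l]|%:R <= (size l)%:R * c.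
Proof.
elim: l => [|u l IHl] ac /=.
  by rewrite mul0r eq_card0.
rewrite -natr1 mulrDl mul1r addrC.
apply: (@le_trans _ _ (#|[pred t | a t u]|%:R + #|[pred t | has (a t) l]|%:R)).
  rewrite -natrD ler_nat -cardUI; apply: leq_trans (leq_addr _ _).
  by apply/subset_leq_card/subsetP => t; rewrite !inE.
by apply: lerD; [apply: ac; left | apply: IHl => v lv; apply: ac; right].
Qed.

Lemma In_has (U : Type) (a : pred U) u l : List.In u l -> a u -> has a l.
Proof. by elim: l => [//|v l IHl] /= [->->//|/IHl ul /ul->]; rewrite orbT. Qed.

(** Acceptance needs only one net function near [f], hence a single tail bound; rejection needs a
    union bound over the net. Since the net lies in [P], a function far from [P] is far from each of
    its members. *)
Lemma net_tester_tolerant (P : (point n d -> bool) -> Prop) (delta e1 e2 : R) :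
    (forall g, List.In g net -> P g) ->
    (forall f, P f -> exists g, List.In g net /\ dist f g <= delta) ->
    e1 + delta + gamma / 2 <= theta -> theta + gamma / 2 <= e2 ->
    (size net)%:R * tail <= 1 / 3 ->
  tolerant_tester P net_tester e1 e2.
Proof.
move=> netP net_cover le1 le2 small f; rewrite net_tester_accept_prob.
have Ns_gt0 : 0 < #|point n d|%:R ^+ s :> R by rewrite exprn_gt0.
have tail_ge0 : 0 <= tail by apply/ltW/exp_gt0.
set acc := [pred t | _]; split=> [[g0 [/net_cover[g [gnet g0g]] /RleP fg0]]|far].
- have size_gt0 : (0 < size net)%N by case: (net) gnet.
  have rej : #|[predC acc]|%:R <= #|point n d|%:R ^+ s * (1 / 3) :> R.
    apply: le_trans (_ : #|point n d|%:R ^+ s * tail <= _); last first.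
      rewrite ler_wpM2l ?(ltW Ns_gt0) // (le_trans _ small) //.
      by rewrite -[leLHS]mul1r ler_wpM2r // ler1n.
    have fg : dist f g + gamma / 2 <= theta.
      have := dist_triangle f g0 g; lra.
    apply: le_trans (empirical_upper_tail fg).
    rewrite ler_nat; apply/subset_leq_card/subsetP => t; rewrite !inE acceptsE.
    by apply: contraR; rewrite -leNgt => ?; apply: In_has gnet _.
  have tot : #|acc|%:R + #|[predC acc]|%:R = #|point n d|%:R ^+ s :> R.
    by rewrite -natrD cardC card_sample natrX.
  apply/RleP; rewrite !RealsE ler_pdivlMr //.
  have -> : (IZR 2 / IZR 3)%R = 2 / 3 :> R by [].
  lra.
- have accs : #|acc|%:R <= #|point n d|%:R ^+ s * (1 / 3) :> R.
    apply: le_trans (_ : (size net)%:R * (#|point n d|%:R ^+ s * tail) <= _); last first.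
      by rewrite mulrCA ler_wpM2l ?(ltW Ns_gt0).
    have -> : #|acc| = #|[pred t : sample | has (fun g =>
        \sum_j (f (t j) != g (t j))%:R <= s%:R * theta) net]|.
      by apply: eq_card => t; rewrite !inE acceptsE.
    apply: card_has_le => g /netP/far/RleP fg.
    by apply: empirical_lower_tail; apply: le_trans fg.
  have : #|acc|%:R / #|point n d|%:R ^+ s <= 1 / 3 :> R.
    by rewrite ler_pdivrMr // mulrC.
  have third (a : R) : a <= 1 / 3 -> 2 / 3 <= 1 - a by lra.
  by move/third => a3; apply/Rle_ge/RleP; rewrite !RealsE.
Qed.

End Tester.
End Sampling.

(** * Nets of k-monotone functions *)

Section Nets.
Import Order.TTheory GRing.Theory Num.Theory.
Local Open Scope ring_scope.
Local Notation R := Rdefinitions.R.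
Local Notation dist := Defs.dist.
Local Arguments exp x%_ring_scope.

(** Each label attained on [P] gets one representative in [P]; excluded middle decides whether the
    label is attained. *)
Lemma net_of_labels (T : Type) (K : finType) (P : T -> Prop) (Phi : T -> K) :
  exists net : seq T, [/\ (size net <= #|K|)%N,
    forall g, List.In g net -> P g
  & forall f, P f -> exists g, List.In g net /\ Phi g = Phi f].
Proof.
suff [net [sz netP cover]] : exists net : seq T, [/\ (size net <= size (enum K))%N,
    forall g, List.In g net -> P g
  & forall f, P f -> Phi f \in enum K -> exists g, List.In g net /\ Phi g = Phi f].
  by exists net; rewrite cardE; split=> // f /cover; apply; rewrite mem_enum.
elim: (enum K) => [|c l [net [sz netP cover]]]; first by exists [::]; split.
have [[g [Pg gc]]|no] := classic (exists g, P g /\ Phi g = c).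
  exists (g :: net); split=> // [h /= [<-//|/netP//]|f Pf].
  rewrite inE => /predU1P[fc|/(cover f Pf)[h [hn hf]]].
    by exists g; rewrite gc fc; split=> //; left.
  by exists h; split=> //; right.
exists net; split=> // [|f Pf]; first exact: leqW.
rewrite inE => /predU1P[fc|/(cover f Pf)//].
by case: no; exists f.
Qed.

(** The threshold [e2 - gamma / 2] leaves a margin [gamma / 2] on both sides. With 72 = 3 * 24, the
    tail is at most [exp (- (3 * kappa))], so the union bound gives [exp (- (2 * kappa))], below 1/3
    because [kappa >= 1]. *)
Lemma tester_of_labels n d (K : finType) (P : (point n d -> bool) -> Prop)
    (Phi : (point n d -> bool) -> K) (e1 e2 gamma kappa : R) (s : nat) :
    (0 < n)%N -> 0 < gamma <= 1 ->
    (forall f g, P f -> P g -> Phi f = Phi g -> dist f g <= e2 - e1 - gamma) ->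
    #|K|%:R <= exp kappa -> 1 <= kappa -> 72 * kappa / gamma ^+ 2 <= s%:R ->
  exists T : ntester n d, [/\ valid_tester T, tolerant_tester P T e1 e2
    & forall q, Rle (INR s) q -> query_bound T q].
Proof.
move=> n_gt0 /andP[g0 g1] labels Kk k1 sk.
have [net [sz netP cover]] := net_of_labels P Phi.
exists (net_tester s net (e2 - gamma / 2)%R); split.
- exact: net_tester_valid.
- apply: (@net_tester_tolerant _ _ _ _ _ _ gamma _ P (e2 - e1 - gamma)%R) => //.
  + by rewrite ltW.
  + move=> f Pf; have [g [gn gf]] := cover f Pf; exists g; split=> //.
    by apply: labels => //; apply: netP.
  + lra.
  + lra.
  + apply: (@le_trans _ _ (exp kappa * exp (- (3 * kappa)))).
      apply: ler_pM => //; first exact/ltW/exp_gt0.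
        by apply: le_trans Kk; rewrite ler_nat.
      apply: ler_exp; rewrite lerN2 ler_pdivlMr //.
      by move: sk; rewrite ler_pdivrMr ?exprn_gt0 // => sk; lra.
    rewrite -expD (_ : kappa - 3 * kappa = - (2 * kappa)); last by ring.
    have e3 : 3 <= exp (2 * kappa) by apply: le_trans (exp_ge1D _); lra.
    have : exp (- (2 * kappa)) * exp (2 * kappa) = 1 by rewrite -expD addNr expR0.
    have := exp_gt0 (- (2 * kappa))%R; nra.
- by move=> q sq o /net_tester_queries->.
Qed.

(** * Labels from coarse functions and from subcube averages *)

Section Labels.
Variables (n m d k : nat).
Hypotheses (n_gt0 : (0 < n)%N) (m_gt0 : (0 < m)%N).

Lemma dist_coarsen (f g : point n d -> bool) : kmonotone k f -> kmonotone k g ->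
  dist f g <= 2 * k%:R * d%:R / m%:R +
    dist (coarsen n_gt0 m_gt0 f) (coarsen n_gt0 m_gt0 g).
Proof.
move=> fk gk; have := coarsen_mismatch n_gt0 m_gt0 fk gk.
rewrite !distE !card_ffun !card_ord -(ler_nat R) !(natrM, natrD, natrX).
set a := (\sum_y _)%:R; set b := (\sum_b _)%:R.
have m0 : 0 < m%:R :> R by rewrite ltr0n.
have n0 : 0 < n%:R :> R by rewrite ltr0n.
have := exprn_gt0 d m0; have := exprn_gt0 d n0.
move: (m%:R ^+ d) (n%:R ^+ d) => Md Nd Nd0 Md0 le.
rewrite ler_pdivrMr // -(ler_pM2l (mulr_gt0 m0 Md0)) -mulrA.
apply: le_trans le _; rewrite le_eqVlt; apply/orP; left; apply/eqP.
by field; rewrite !gt_eqF.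
Qed.

Lemma coarsen_labels (f g : point n d -> bool) : kmonotone k f -> kmonotone k g ->
  [ffun b => coarsen n_gt0 m_gt0 f b] = [ffun b => coarsen n_gt0 m_gt0 g b] ->
  dist f g <= 2 * k%:R * d%:R / m%:R.
Proof.
move=> fk gk /ffunP fg; apply: le_trans (dist_coarsen fk gk) _.
rewrite [X in _ + X]distE big1 ?mul0r ?addr0 // => b _.
by have := fg b; rewrite !ffunE => ->; rewrite eqxx.
Qed.

Variables (D M : nat).
Hypothesis M_gt0 : (0 < M)%N.

Lemma avgs_ge0_le1 (l : seq 'I_d) (F : point m d -> R) :
  (forall x, 0 <= F x <= 1) -> forall x, 0 <= avgs l F x <= 1.
Proof.
elim: l F => [//|i l IHl] F F01; apply: IHl => x.
rewrite divr_ge0 ?sumr_ge0 //=; last by move=> a _; case/andP: (F01 (upd x i a)).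
rewrite ler_pdivrMr ?ltr0n // mul1r -[X in _ <= X%:R]card_ord -sumr_const.
by apply: ler_sum => a _; case/andP: (F01 (upd x i a)).
Qed.

(* A subcube fixing at most D coordinates, as the list of its fixed coordinates
   with their values, padded with [None]. *)
Definition subcube := {ffun 'I_D -> option ('I_d * 'I_m)}.

Definition fixed (w : subcube) : {set 'I_d} :=
  [set i | [exists j, [exists a, w j == Some (i, a)]]].

(** Free coordinates get the default 0, which [subcube_avg] averages away. *)
Definition base (w : subcube) : point m d :=
  [ffun i => odflt (Ordinal m_gt0) [pick a | [exists j, w j == Some (i, a)]]].

Definition subcube_of (S : {set 'I_d}) (x : point m d) : subcube :=
  [ffun j => nth None [seq Some (i, x i) | i <- enum S] (nat_of_ord j)].

Lemma subcube_ofP (S : {set 'I_d}) x i a : (#|S| <= D)%N ->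
  [exists j, subcube_of S x j == Some (i, a)] = (i \in S) && (a == x i).
Proof.
move=> SD; apply/existsP/andP => [[j]|[iS /eqP->]].
  rewrite ffunE; case: (ltnP j (size (enum S))) => jS; last first.
    by rewrite nth_default ?size_map.
  rewrite (nth_map i) // => /eqP[ji <-].
  by have := mem_nth i jS; rewrite ji mem_enum eqxx.
have iS' : (index i (enum S) < size (enum S))%N by rewrite index_mem mem_enum.
have iD : (index i (enum S) < D)%N by apply: leq_trans SD; rewrite cardE.
by exists (Ordinal iD); rewrite ffunE /= (nth_map i) // nth_index ?mem_enum.
Qed.

Definition subcube_avg (f : point m d -> bool) (w : subcube) : R :=
  avgs [seq i <- enum 'I_d | i \notin fixed w] (indicator R f) (base w).

Lemma subcube_avg_of f (S : {set 'I_d}) x : (#|S| <= D)%N ->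
  subcube_avg f (subcube_of S x) = avgs [seq i <- enum 'I_d | i \notin S] (indicator R f) x.
Proof.
move=> SD; rewrite /subcube_avg.
have -> : fixed (subcube_of S x) = S.
  apply/setP => i; rewrite inE; apply/existsP/idP => [[j /existsP[a ja]]|iS].
    have : [exists j, subcube_of S x j == Some (i, a)] by apply/existsP; exists j.
    by rewrite subcube_ofP // => /andP[].
  have : [exists j, subcube_of S x j == Some (i, x i)] by rewrite subcube_ofP // iS eqxx.
  by case/existsP => j jx; exists j; apply/existsP; exists (x i).
apply: avgs_eq_off => i; rewrite !inE mem_filter mem_enum andbT negbK => iS.
rewrite ffunE; case: pickP => [a|/(_ (x i))]; rewrite subcube_ofP // iS /=.
  by move/eqP.
by rewrite eqxx.
Qed.

(** Averages are truncated to multiples of [1 / M]; there are [M.+1] values because an average may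
    equal 1. *)
Definition rounded_avgs (f : point m d -> bool) : {ffun subcube -> 'I_M.+1} :=
  [ffun w => inord (Num.truncn (subcube_avg f w * M%:R))].

Lemma rounded_avgs_eq f g w : rounded_avgs f = rounded_avgs g ->
  `|subcube_avg f w - subcube_avg g w| <= M%:R^-1.
Proof.
move/ffunP/(_ w); rewrite !ffunE => eq_fg.
have M0 : 0 < M%:R :> R by rewrite ltr0n.
have avg01 h : 0 <= subcube_avg h w <= 1.
  by apply: avgs_ge0_le1 => x; rewrite /indicator; case: (h x); rewrite ?ler01 ?lexx.
have tr_le h : (Num.truncn (subcube_avg h w * M%:R) < M.+1)%N.
  have /andP[h0 h1] := avg01 h; rewrite ltnS -(ler_nat R).
  apply: (@le_trans _ _ (subcube_avg h w * M%:R)).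
    by rewrite truncn_le mulr_ge0.
  by rewrite -[leRHS]mul1r ler_wpM2r.
have := congr1 val eq_fg; rewrite /= !inordK // => eq_tr.
have itv h : (Num.truncn (subcube_avg h w * M%:R))%:R <= subcube_avg h w * M%:R
    < (Num.truncn (subcube_avg h w * M%:R)).+1%:R.
  by apply: truncn_itv; case/andP: (avg01 h) => h0 _; rewrite mulr_ge0.
have /andP[f1 f2] := itv f; have /andP[g1 g2] := itv g.
rewrite eq_tr -!natr1 in f1 f2 g1 g2.
rewrite -[leRHS]mul1r ler_pdivlMr //.
rewrite -[X in _ * X <= _](ger0_norm (ltW M0)) -normrM mulrBl.
by rewrite ler_norml; apply/andP; split; lra.
Qed.

(** The three terms are the errors of coarsening, of rounding the averages, and of keeping only
    subcubes that fix fewer than [D.+1] coordinates. *)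
Lemma low_degree_labels (sigma : R) (f g : point n d -> bool) :
    0 < sigma -> d%:R <= sigma ^+ 2 -> kmonotone k f -> kmonotone k g ->
    rounded_avgs (coarsen n_gt0 m_gt0 f) = rounded_avgs (coarsen n_gt0 m_gt0 g) ->
  dist f g <= 2 * k%:R * d%:R / m%:R + 5 ^+ d / M%:R ^+ 2 + 4 * k%:R * sigma / D.+1%:R.
Proof.
move=> s0 ds fk gk eq_fg; apply: le_trans (dist_coarsen fk gk) _.
rewrite -addrA lerD2l.
have M0 : 0 <= M%:R^-1 :> R by rewrite invr_ge0.
have := @kmonotone_low_degree R m d m_gt0 k _ _ D.+1 M%:R^-1 sigma
  (@kmonotone_coarsen _ _ _ n_gt0 m_gt0 _ _ fk)
  (@kmonotone_coarsen _ _ _ n_gt0 m_gt0 _ _ gk) M0 s0 ds _.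
rewrite distE => low; rewrite ler_pdivrMr; last first.
  by rewrite ltr0n card_ffun !card_ord expn_gt0 m_gt0.
rewrite -(@ler_pM2l _ D.+1%:R) ?ltr0n //.
apply: le_trans (low _) _.
  by move=> S SD x; rewrite -!subcube_avg_of //; apply: rounded_avgs_eq.
have M1 : M%:R != 0 :> R by rewrite pnatr_eq0 -lt0n.
have D1 : D.+1%:R != 0 :> R by rewrite pnatr_eq0.
move: (M%:R : R) (D.+1%:R : R) M1 D1 => M' D' M1 D1.
by rewrite le_eqVlt; apply/orP; left; apply/eqP; field; rewrite M1 D1.
Qed.

Lemma card_rounded_avgs :
  #|{ffun subcube -> 'I_M.+1}| = (M.+1 ^ ((d * m).+1 ^ D))%N.
Proof. by rewrite !card_ffun card_option card_prod !card_ord. Qed.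

End Labels.
End Nets.

(** * Query bounds *)

Lemma INR_ceil x : 0 <= x -> exists j : nat, x < INR j <= x + 1.
Proof.
move=> x0; have [u1 u2] := archimed x.
exists (Z.to_nat (up x)); rewrite INR_IZR_INZ Z2Nat.id; first by Rlra.
apply: le_IZR; Rlra.
Qed.

Lemma INR_ge1 (j : nat) : (1 <= j)%N -> 1 <= INR j.
Proof. by move=> j1; apply: (le_INR 1); apply/leP. Qed.

(** Half of [eps] is spent on the precision of the net; the remaining gap is at least [eps / 2],
    which turns 72 into 288. The step to 289 absorbs the rounding of the sample size, as
    [kappa / eps ^ 2 >= 1]. *)
Lemma tester_from_labels n d (K : finType) (P : (point n d -> bool) -> Prop)
    (Phi : (point n d -> bool) -> K) (e1 e2 eps kappa q : R) :
    (1 <= n)%N -> 0 <= e1 -> e2 <= 1 -> 0 < eps <= e2 - e1 ->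
    (forall f g, P f -> P g -> Phi f = Phi g -> Defs.dist f g <= eps / 2) ->
    INR #|K| <= exp kappa -> 1 <= kappa -> 289 * kappa / eps ^ 2 <= q ->
  exists T : ntester n d,
    valid_tester T /\ tolerant_tester P T e1 e2 /\ query_bound T q.
Proof.
move=> n1 e10 e21 [eps0 eps1] labels Kk k1 kq.
have eps2 : 0 < eps ^ 2 <= 1 by Rnra.
have gam2 : eps ^ 2 / 4 <= (e2 - e1 - eps / 2) ^ 2 by Rnra.
have kg : 72 * kappa / (e2 - e1 - eps / 2) ^ 2 <= 288 * kappa / eps ^ 2.
  apply: (Rmult_le_reg_r (eps ^ 2 * (e2 - e1 - eps / 2) ^ 2)); first by Rnra.
  have -> : 72 * kappa / (e2 - e1 - eps / 2) ^ 2 * (eps ^ 2 * (e2 - e1 - eps / 2) ^ 2)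
    = 72 * kappa * eps ^ 2 by Rfield; Rnra.
  have -> : 288 * kappa / eps ^ 2 * (eps ^ 2 * (e2 - e1 - eps / 2) ^ 2)
    = 288 * kappa * (e2 - e1 - eps / 2) ^ 2 by Rfield; Rlra.
  Rnra.
have k0 : 0 <= 288 * kappa / eps ^ 2.
  by apply: Rmult_le_pos; [Rlra | apply/Rlt_le/Rinv_0_lt_compat; Rlra].
have [s [s1 s2]] := INR_ceil k0.
have last1 : 1 <= kappa / eps ^ 2.
  apply: (Rmult_le_reg_r (eps ^ 2)); first by Rlra.
  have -> : kappa / eps ^ 2 * eps ^ 2 = kappa by Rfield; Rlra.
  Rlra.
pose gamma := e2 - e1 - eps / 2.
have gam01 : is_true (0 < gamma <= 1)%R.
  apply/andP; split; [apply/RltP; change (0 < gamma) | apply/RleP; change (gamma <= 1)];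
    rewrite /gamma; Rlra.
have [||||T [valid tol queries]] :=
  @tester_of_labels n d K P Phi e1 e2 gamma kappa s n1 gam01.
- move=> f g Pf Pg fg; have fg_close := labels f g Pf Pg fg.
  by apply/RleP; change (Defs.dist f g <= e2 - e1 - gamma); rewrite /gamma; Rlra.
- by apply/RleP; rewrite -INRE.
- exact/RleP.
- by have /RleP := Rle_trans _ _ _ kg (Rlt_le _ _ s1); rewrite !RealsE.
exists T; split=> //; split=> //; apply: queries.
have split_q : 289 * kappa / eps ^ 2 = 288 * kappa / eps ^ 2 + kappa / eps ^ 2.
  by Rfield; Rlra.
rewrite split_q in kq; Rlra.
Qed.

Lemma Rle_div_of_le_mul a b c : 0 < b -> a <= c * b -> a / b <= c.
Proof.
move=> b0 ab; apply: (Rmult_le_reg_r b) => //.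
by have -> : a / b * b = a by Rfield; Rlra.
Qed.

Lemma INR_expn (a b : nat) : INR (a ^ b)%N = INR a ^ b.
Proof. by rewrite !INRE GRing.natrX RpowE. Qed.

Lemma exp_INR_mul x (j : nat) : exp (INR j * x) = exp x ^ j.
Proof. by have := expMn x j; rewrite !RealsE. Qed.

Lemma INR_expn_le_exp (a j : nat) x : INR a <= exp x -> INR (a ^ j)%N <= exp (INR j * x).
Proof.
by move=> ax; rewrite INR_expn exp_INR_mul; apply: pow_incr; split=> //; apply: pos_INR.
Qed.

Lemma ge1_mul x y : 1 <= x -> 1 <= y -> 1 <= x * y.
Proof. by move=> *; Rnra. Qed.

Lemma fully_tolerant_tester (n d k : nat) (e1 e2 : R) :
    (1 <= n)%N -> (1 <= d)%N -> (1 <= k)%N -> 0 <= e1 -> e1 < e2 -> e2 <= 1 ->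
  exists T : ntester n d, valid_tester T /\ tolerant_tester (kmonotone k) T e1 e2 /\
    query_bound T (289 * bound1 d k e1 e2).
Proof.
move=> n1 d1 k1 e10 e12 e21; rewrite /bound1.
have K1 := INR_ge1 k1; have D1 := INR_ge1 d1; have KD := ge1_mul K1 D1.
set A := 5 * INR k * INR d / (e2 - e1).
have Ae : A * (e2 - e1) = 5 * INR k * INR d by rewrite /A; Rfield; Rlra.
have A5 : 5 <= A by apply: (Rmult_le_reg_r (e2 - e1)); Rnra.
(* Since [A >= 5], [m > A - 1] gives [m >= 4 * A / 5], which makes the coarsening error at most half
   of [e2 - e1]; and [m <= A] keeps [m ^ d] below [A ^ d]. *)
have [m [m1 m2]] : exists m : nat, A - 1 < INR m <= A - 1 + 1 by apply: INR_ceil; Rlra.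
have m_gt0 : (0 < m)%N by apply/ltP/INR_lt; rewrite /=; Rlra.
have n_gt0 : (0 < n)%N by [].
apply: (@tester_from_labels n d {ffun point m d -> bool} _
  (fun f => [ffun b => coarsen n_gt0 m_gt0 f b]) e1 e2 (e2 - e1) (INR (m ^ d)%N)) => //.
- by Rlra.
- move=> f g fk gk fg; have /RleP := coarsen_labels fk gk fg.
  move/Rle_trans; apply.
  have -> : (2 * k%:R * d%:R / m%:R)%R = 2 * INR k * INR d / INR m by rewrite !RealsE.
  by apply: Rle_div_of_le_mul; Rnra.
- rewrite card_ffun card_bool card_ffun !card_ord -[INR (m ^ d)]Rmult_1_r.
  apply: INR_expn_le_exp; have := exp_ineq1_le 1; rewrite /=; Rlra.
- by apply: INR_ge1; rewrite expn_gt0 m_gt0.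
- rewrite INR_expn /Rdiv Rmult_1_l !Rmult_assoc [_ * / _]Rmult_comm.
  apply: Rmult_le_compat_l; first by Rlra.
  apply: Rmult_le_compat_l; first by apply/Rlt_le/Rinv_0_lt_compat/pow_lt; Rlra.
  by apply: pow_incr; split; [apply: pos_INR | Rlra].
Qed.

(** With [B] the value of [bound2], the number of subcubes has base [(d * m).+1] polynomial in [B]
    and exponent [D] linear in [B]. The other factors in the sample size are polynomial in [B], so
    the total is exponential in [B * ln (B + 2)]. *)
Lemma tolerant_tester_low_degree (n d k : nat) (e1 e2 : R) :
    (1 <= n)%N -> (1 <= d)%N -> (1 <= k)%N -> 0 <= e1 -> 3 * e1 < e2 -> e2 <= 1 ->
  exists T : ntester n d, valid_tester T /\ tolerant_tester (kmonotone k) T e1 e2 /\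
    query_bound T (Rpower 2 (470 * bound2 d k e1 e2 * ln (bound2 d k e1 e2 + 2))).
Proof.
move=> n1 d1 k1 e10 e12 e21; rewrite /bound2.
have K1 := INR_ge1 k1; have D1 := INR_ge1 d1.
have sqr_sigma : sqrt (INR d) * sqrt (INR d) = INR d by apply: sqrt_sqrt; Rlra.
have sigma1 : 1 <= sqrt (INR d) by rewrite -sqrt_1; apply: sqrt_le_1; Rlra.
have [eps [epsE eps0 eps1 epsd]] : exists eps,
    [/\ eps = e2 - 3 * e1, 0 < eps, eps <= 1 & eps <= e2 - e1].
  by exists (e2 - 3 * e1); split; Rlra.
rewrite -epsE.
move: (sqrt (INR d)) sqr_sigma sigma1 => sigma sqr_sigma sigma1.
have [u [u_eps u1]] : exists u, u * eps = 1 /\ 1 <= u.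
  exists (/ eps); split; first by Rfield; Rlra.
  by rewrite -Rinv_1; apply: Rinv_le_contravar; Rlra.
have u_inv : u = / eps.
  apply: (Rmult_eq_reg_r eps); last by Rlra.
  by rewrite u_eps Rinv_l //; Rlra.
have -> : INR k * sigma / eps ^ 2 = INR k * sigma * u ^ 2.
  by rewrite u_inv; Rfield; Rlra.
have uu := ge1_mul u1 u1; have Ksigma := ge1_mul K1 sigma1.
have [B BE] : exists B, B = INR k * sigma * u ^ 2 by exists (INR k * sigma * u ^ 2).
rewrite -BE.
have uB : u <= B.
  have -> : B = u * (INR k * sigma * u) by rewrite BE; Rring.
  have := ge1_mul Ksigma u1; Rnra.
have KsuB : INR k * sigma * u <= B.
  have -> : B = INR k * sigma * u * u by rewrite BE; Rring.
  have := ge1_mul Ksigma u1; Rnra.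
have sigmaB : sigma <= B.
  have -> : B = sigma * (INR k * (u * u)) by rewrite BE; Rring.
  have := ge1_mul K1 uu; Rnra.
have B1 : 1 <= B by Rlra.
have dB : INR d <= B ^ 2 by rewrite -sqr_sigma; Rnra.
have KduB : INR k * INR d * u <= B ^ 2.
  have -> : INR k * INR d * u = INR k * sigma * u * sigma by rewrite -sqr_sigma; Rring.
  have := ge1_mul Ksigma u1; Rnra.
have Kdu1 : 1 <= INR k * INR d * u by apply: ge1_mul => //; apply: ge1_mul.
(* The choices of [m], [D] and [M] make the three errors at most [eps / 4], [eps / 8] and [eps / 8],
   in total [eps / 2]. *)
have [m [m1 m2]] : exists m : nat,
    8 * (INR k * INR d * u) < INR m <= 8 * (INR k * INR d * u) + 1.
  by apply: INR_ceil; Rlra.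
have [D [t1 t2]] : exists D : nat,
    32 * (INR k * sigma * u) - 1 < INR D <= 32 * (INR k * sigma * u) - 1 + 1.
  by apply: INR_ceil; have := ge1_mul Ksigma u1; Rlra.
have pow5 : 1 <= 5 ^ d by apply: pow_R1_Rle; Rlra.
have [M [M1 M2]] : exists M : nat, 8 * (5 ^ d * u) < INR M <= 8 * (5 ^ d * u) + 1.
  by apply: INR_ceil; have := ge1_mul pow5 u1; Rlra.
have pow5u := ge1_mul pow5 u1.
have m_gt0 : (0 < m)%N by apply/ltP/INR_lt; rewrite /=; Rlra.
have M_gt0 : (0 < M)%N by apply/ltP/INR_lt; rewrite /=; Rlra.
have n_gt0 : (0 < n)%N by [].
(* A bound for the logarithm of [M.+1], which is at most [10 * (5 ^ d * u)]: use [10 <= exp 4],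
   [5 <= exp 2] and [u <= exp u]. *)
pose kappa0 := 4 + 2 * INR d + u.
have [L [LE expL L1]] : exists L, [/\ L = ln (B + 2), exp L = B + 2 & 1 <= L].
  have expL : exp (ln (B + 2)) = B + 2 by apply: exp_ln; Rlra.
  exists (ln (B + 2)); split=> //; apply: Rnot_lt_le => /exp_increasing.
  by have := exp_le_3; Rlra.
rewrite -LE.
have expnL (j : nat) : exp (INR j * L) = (B + 2) ^ j by rewrite exp_INR_mul expL.
(* The exponent 7 is 3 + 4: the constant 27 goes into [(B + 2) ^ 3] and [B ^ 4] into
   [(B + 2) ^ 4]. *)
have dm_le : INR (d * m).+1 <= exp (7 * L).
  have -> : 7 * L = INR 7 * L by rewrite /=; Rring.
  rewrite expnL S_INR.
  have -> : INR (d * m) = INR d * INR m by rewrite !INRE GRing.natrM.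
  have dm4 : INR d * INR m <= B ^ 2 * (8 * B ^ 2 + 1).
    by apply: Rmult_le_compat; Rlra.
  have B4 : 1 <= B ^ 4 by apply: pow_R1_Rle.
  have B2 : 1 <= B ^ 2 by apply: pow_R1_Rle.
  have B24 : B ^ 2 <= B ^ 4.
    by rewrite (_ : B ^ 4 = B ^ 2 * B ^ 2); [Rnra | Rring].
  apply: (Rle_trans _ (27 * B ^ 4)); first by Rlra.
  have -> : (B + 2) ^ 7 = (B + 2) ^ 3 * (B + 2) ^ 4 by Rring.
  have y4 : B ^ 4 <= (B + 2) ^ 4 by apply: pow_incr; Rlra.
  have y3 : 3 ^ 3 <= (B + 2) ^ 3 by apply: pow_incr; Rlra.
  by apply: Rmult_le_compat; Rlra.
have dmD_le : INR ((d * m).+1 ^ D)%N <= exp (224 * (B * L)).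
  apply: Rle_trans (INR_expn_le_exp D dm_le) _.
  have DL : INR D * (7 * L) <= 224 * (B * L).
    have -> : 224 * (B * L) = (32 * B) * (7 * L) by Rring.
    by apply: Rmult_le_compat_r; Rlra.
  by case: DL => [/exp_increasing/Rlt_le|->] //; apply: Rle_refl.
have kappa0_ge1 : 1 <= kappa0 by rewrite /kappa0; Rlra.
have M_le : INR M.+1 <= exp kappa0.
  rewrite S_INR /kappa0 !exp_plus.
  have e1_2 : 3 / 2 <= exp (1 / 2) by have := exp_ineq1_le (1 / 2); Rlra.
  have e2E : exp 2 = exp (1 / 2) ^ 4 by rewrite -exp_INR_mul; congr exp; rewrite /=; Rfield.
  have e2_5 : 5 <= exp 2.
    rewrite e2E; have : (3 / 2) ^ 4 <= exp (1 / 2) ^ 4 by apply: pow_incr; Rlra.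
    Rlra.
  have e4_10 : 10 <= exp 4.
    have -> : 4 = 2 + 2 by Rring.
    rewrite exp_plus; Rnra.
  have e5d : 5 ^ d <= exp (2 * INR d).
    by rewrite Rmult_comm exp_INR_mul; apply: pow_incr; Rlra.
  have eu : u <= exp u by have := exp_ineq1_le u; Rlra.
  apply: (Rle_trans _ (10 * (5 ^ d * u))); first by Rlra.
  rewrite Rmult_assoc; apply: Rmult_le_compat; [Rlra|Rlra|Rlra|].
  by apply: Rmult_le_compat; Rlra.
apply: (@tester_from_labels n d {ffun subcube m d D -> 'I_M.+1} _
  (fun f => rounded_avgs m_gt0 D M (coarsen n_gt0 m_gt0 f)) e1 e2 eps
  (INR ((d * m).+1 ^ D)%N * kappa0)) => //.
- move=> f g fk gk fg.
  have sigma0 : is_true (0 < sigma)%R by apply/RltP; change (0 < sigma); Rlra.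
  have sigma2 : is_true (d%:R <= sigma ^+ 2)%R.
    by apply/RleP; rewrite -!RealsE; Rlra.
  have /RleP := low_degree_labels M_gt0 sigma0 sigma2 fk gk fg.
  move/Rle_trans; apply.
  have -> : (2 * k%:R * d%:R / m%:R + 5 ^+ d / M%:R ^+ 2 + 4 * k%:R * sigma / D.+1%:R)%R =
    2 * INR k * INR d / INR m + 5 ^ d / INR M ^ 2 + 4 * INR k * sigma / INR D.+1.
    by rewrite !RealsE.
  have scale_eps c x y : c * (x * u) <= y -> c * x <= eps * y.
    move=> cy; have -> : c * x = eps * (c * (x * u)).
      by rewrite (_ : eps * _ = c * x * (u * eps)); [rewrite u_eps | ]; Rring.
    by apply: Rmult_le_compat_l; Rlra.
  have b1 : 2 * INR k * INR d / INR m <= eps / 4.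
    have := scale_eps _ _ _ (Rlt_le _ _ m1).
    by move=> ?; apply: Rle_div_of_le_mul; Rlra.
  have b2 : 5 ^ d / INR M ^ 2 <= eps / 8.
    have := scale_eps _ _ _ (Rlt_le _ _ M1).
    have M1' : 1 <= INR M by Rlra.
    have MM : INR M <= INR M ^ 2 by Rnra.
    have eM : eps * INR M <= eps * INR M ^ 2 by apply: Rmult_le_compat_l; Rlra.
    by move=> ?; apply: Rle_div_of_le_mul; [apply: pow_lt; Rlra | Rlra].
  have b3 : 4 * INR k * sigma / INR D.+1 <= eps / 8.
    have D1' : 32 * (INR k * sigma * u) <= INR D.+1 by rewrite S_INR; Rlra.
    have := scale_eps _ _ _ D1'.
    by move=> ?; apply: Rle_div_of_le_mul; have := ge1_mul Ksigma u1; Rlra.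
  Rlra.
- rewrite card_rounded_avgs //; exact: INR_expn_le_exp.
- by apply: ge1_mul => //; apply: INR_ge1; rewrite expn_gt0.
(* Here 289 * 7 = 2023 is below [3 ^ 7] = 2187, and 11 = 7 + 4. *)
have kappa0_le : 289 * kappa0 * u ^ 2 <= exp (11 * L).
  have -> : 11 * L = INR 11 * L by rewrite /=; Rring.
  rewrite expnL; have -> : (B + 2) ^ 11 = (B + 2) ^ 7 * (B + 2) ^ 4 by Rring.
  have y4 : B ^ 4 <= (B + 2) ^ 4 by apply: pow_incr; Rlra.
  have y7 : 3 ^ 7 <= (B + 2) ^ 7 by apply: pow_incr; Rlra.
  have B2 : B <= B ^ 2 by Rnra.
  have k7 : kappa0 <= 7 * B ^ 2 by rewrite /kappa0; Rlra.
  have u2 : u ^ 2 <= B ^ 2 by apply: pow_incr; Rlra.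
  have ku : kappa0 * u ^ 2 <= 7 * B ^ 2 * B ^ 2.
    by apply: Rmult_le_compat; try Rlra; apply: pow_le; Rlra.
  apply: (Rle_trans _ (3 ^ 7 * B ^ 4)).
    have -> : 3 ^ 7 * B ^ 4 = 2187 * (B ^ 2 * B ^ 2) by Rring.
    have : 0 <= B ^ 2 * B ^ 2 by apply: Rmult_le_pos; Rlra.
    Rlra.
  by apply: Rmult_le_compat; try Rlra; apply: pow_le; Rlra.
have -> : 289 * (INR ((d * m).+1 ^ D)%N * kappa0) / eps ^ 2 =
    INR ((d * m).+1 ^ D)%N * (289 * kappa0 * u ^ 2).
  by rewrite u_inv; Rfield; Rlra.
apply: (Rle_trans _ (exp (224 * (B * L)) * exp (11 * L))).
  apply: Rmult_le_compat => //; first exact: pos_INR.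
  by apply: Rmult_le_pos; [Rlra | apply: pow_le; Rlra].
rewrite -exp_plus /Rpower.
(* Changing to base 2 costs a factor 2, since [ln 2] exceeds 1/2: 470 = 2 * (224 + 11). *)
have ln2 := ln_lt_2.
have BL : L <= B * L by Rnra.
have BL2 : B * L * / 2 <= B * L * ln 2 by apply: Rmult_le_compat_l; Rlra.
have le_exponent : 224 * (B * L) + 11 * L <= 470 * B * L * ln 2 by Rlra.
by case: le_exponent => [/exp_increasing/Rlt_le|->] //; apply: Rle_refl.
Qed.

Theorem theorem1p8 :
  (* (1): fully tolerant, q = O~( (1/(e2-e1)^2) (5kd/(e2-e1))^d ) *)
  (exists (C : R) (c : nat), 0 < C /\
    forall (n d k : nat) (e1 e2 : R),
      (1 <= n)%N -> (1 <= d)%N -> (1 <= k)%N ->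
      0 <= e1 -> e1 < e2 -> e2 <= 1 ->
      exists T : ntester n d,
        valid_tester T /\
        tolerant_tester (kmonotone k) T e1 e2 /\
        query_bound T (C * bound1 d k e1 e2 * (ln (bound1 d k e1 e2 + 2)) ^ c))
  /\
  (* (2): tolerant for e2 > 3 e1, q = 2^{O~( k sqrt d / (e2 - 3 e1)^2 )} *)
  (exists (C : R) (c : nat), 0 < C /\
    forall (n d k : nat) (e1 e2 : R),
      (1 <= n)%N -> (1 <= d)%N -> (1 <= k)%N ->
      0 <= e1 -> 3 * e1 < e2 -> e2 <= 1 ->
      exists T : ntester n d,
        valid_tester T /\
        tolerant_tester (kmonotone k) T e1 e2 /\
        query_bound T (Rpower 2 (C * bound2 d k e1 e2 * (ln (bound2 d k e1 e2 + 2)) ^ c))).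
Proof.
split.
  exists 289, 0%N; split; first by Rlra.
  move=> n d k e1 e2 n1 d1 k1 e10 e12 e21; rewrite /= Rmult_1_r.
  exact: fully_tolerant_tester.
exists 470, 1%N; split; first by Rlra.
move=> n d k e1 e2 n1 d1 k1 e10 e12 e21; rewrite pow_1.
exact: tolerant_tester_low_degree.
Qed.
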